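(* Let $p \in (1,\infty)$, $\lambda \geq 2$, and let $(X_n)_{n\in\mathbb{N}}$ be a sequence of Banach spaces. (i) If every $X_n$ has property $\lambda$-HFC$_{p,d}$, then for every $\varepsilon>0$ the space $X=\left(\sum_{n\in\mathbb{N}} X_n\right)_{\ell_p}$ has property $(\lambda+\varepsilon)$-HFC$_{p,d}$. (ii) If every $X_n$ has property $\lambda$-HIC$_{p,d}$, then for every $\varepsilon>0$ the space $X=\left(\sum_{n\in\mathbb{N}} X_n\right)_{\ell_p}$ has property $(\lambda+\varepsilon)$-HIC$_{p,d}$.
   Context: For a sequence of Banach spaces $(X_n)$ and $p\in[1,\infty)$, $\left(\sum_n X_n\right)_{\ell_p}$ is the Banach space of sequences $(x_n)$ with $x_n\in X_n$ and $\|(x_n)\|=\left(\sum_n\|x_n\|^p\right)^{1/p}<\infty$. For $\mathbb{M}\subset\mathbb{N}$ infinite and $k\in\mathbb{N}$, $[\mathbb{M}]^k=\{\overline{n}=(n_1,\dots,n_k)\in\mathbb{M}^k: n_1<\cdots<n_k\}$, equipped with the Hamming distance $d_{\mathbb{H}}(\overline{n},\overline{m})=|\{j: n_j\neq m_j\}|$; $[\mathbb{N}]^\omega$ denotes the set of infinite subsets of $\mathbb{N}$. Set $I_k(\mathbb{M})=\{(\overline{n},\overline{m})\in[\mathbb{M}]^k\times[\mathbb{M}]^k: n_1<m_1<n_2<m_2<\cdots<n_k<m_k\}$ and, for $1\le j\le k$, $H_j(\mathbb{M})=\{(\overline{n},\overline{m})\in[\mathbb{M}]^k\times[\mathbb{M}]^k: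 n_i=m_i \text{ for all } i\neq j,\ n_j<m_j\}$. For a map $f:[\mathbb{N}]^k\to (X,d)$, $\operatorname{Lip}_j(f)=\sup_{(\overline{n},\overline{m})\in H_j(\mathbb{N})} d(f(\overline{n}),f(\overline{m}))$. A metric space $(X,d)$ has property $\lambda$-HFC$_{p,d}$ (resp. $\lambda$-HIC$_{p,d}$), for $\lambda>0$, $p\in(1,\infty)$, if for every $k\in\mathbb{N}$ and every bounded function $f:[\mathbb{N}]^k\to X$ there exists $\mathbb{M}\in[\mathbb{N}]^\omega$ such that $d(f(\overline{n}),f(\overline{m}))\le\lambda\left(\sum_{j=1}^k\operatorname{Lip}_j(f)^p\right)^{1/p}$ for all $\overline{n},\overline{m}\in[\mathbb{M}]^k$ (resp. for all $(\overline{n},\overline{m})\in I_k(\mathbb{M})$). *)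

(* Defs.v *)
From HB Require Import structures.
From mathcomp Require Import all_boot all_order all_algebra.
From mathcomp Require Import all_classical all_reals all_analysis.
Set Implicit Arguments. Unset Strict Implicit. Unset Printing Implicit Defensive.
Import Order.TTheory GRing.Theory Num.Theory.
Import numFieldNormedType.Exports.
Local Open Scope classical_set_scope.
Local Open Scope ring_scope.

Definition incr (k : nat) (s : k.-tuple nat) : bool := sorted ltn s.

Definition in_incr (M : set nat) (k : nat) (s : k.-tuple nat) : Prop :=
  incr s /\ forall j : 'I_k, M (tnth s j).

Definition Hrel (k : nat) (j : 'I_k) (n m : k.-tuple nat) : Prop :=
  incr n /\ incr m /\ (forall i : 'I_k, i != j -> tnth n i = tnth m i)
  /\ (tnth n j < tnth m j)%N.

Definition Irel (M : set nat) (k : nat) (n m : k.-tuple nat) : Prop :=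
  in_incr M n /\ in_incr M m /\
  (forall i : 'I_k, (tnth n i < tnth m i)%N) /\
  (forall i i' : 'I_k, (i' = i.+1 :> nat) -> (tnth m i < tnth n i')%N).

Section HC.
Variables (R : realType) (T : Type) (d : T -> T -> R).

Definition bounded_on_incr (k : nat) (f : k.-tuple nat -> T) : Prop :=
  exists C : R, forall n m, incr n -> incr m -> d (f n) (f m) <= C.

Definition Lipj (k : nat) (f : k.-tuple nat -> T) (j : 'I_k) : R :=
  sup [set r : R | exists n m, Hrel j n m /\ r = d (f n) (f m)].

Definition Lip_bound (p : R) (k : nat) (f : k.-tuple nat -> T) : R :=
  (\sum_(j < k) (Lipj f j) `^ p) `^ (p^-1).

Definition HFC (lam p : R) : Prop :=
  forall (k : nat) (f : k.-tuple nat -> T), bounded_on_incr f ->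
  exists M : set nat, ~ finite_set M /\
    forall n m, in_incr M n -> in_incr M m ->
      d (f n) (f m) <= lam * Lip_bound p f.

Definition HIC (lam p : R) : Prop :=
  forall (k : nat) (f : k.-tuple nat -> T), bounded_on_incr f ->
  exists M : set nat, ~ finite_set M /\
    forall n m, Irel M n m ->
      d (f n) (f m) <= lam * Lip_bound p f.
End HC.

Definition normdist (R : realType) (V : normedModType R) (x y : V) : R :=
  `|x - y|.

Section lpsum.
Variables (R : realType) (X : nat -> completeNormedModType R) (p : R).

Definition lp_summable (x : forall n, X n) : Prop :=
  cvgn (series (fun n => `|x n| `^ p)).

Record lp_sum := LpSum { lp_val : forall n, X n ; lp_valP : lp_summable lp_val }.

Definition lp_dist (x y : lp_sum) : R :=
  (limn (series (fun n => `|lp_val x n - lp_val y n| `^ p))) `^ (p^-1).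
End lpsum.

(* Main.v *)
(* Write f(n) in X as (f_i(n))_i.  By Ramsey's theorem one may pass to a subset on
   which f(n) is, up to a small error in norm, carried by a fixed head [0, N) and by
   disjoint blocks J(n_1), ..., J(n_k), where J(v) depends only on the integer v: on a
   set homogeneous for "the mass of f(n) on [a, b) is at most eta", with a < b in a
   given gap of n, the answer must be yes, since f is bounded.  On the head, Ramsey
   makes |f_i(n) - f_i(m)|^p nearly equal to a constant kappa_ij for all (n, m) in H_j,
   and the property of X_i bounds the head of f(n) - f(m) by
   lam^p sum_j sum_(i < N) kappa_ij.  When the j-th entry of n moves, the block J(n_j)
   is vacated, so Lip_j(f)^p dominates sum_(i < N) kappa_ij plus the mass of f(n) on
   J(n_j).  The triangle inequality costs a factor 2 <= lam on the blocks, and the two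
   contributions add up to lam^p sum_j Lip_j(f)^p.

   Sequences of integers are reindexed by strictly increasing maps instead of being
   restricted to infinite subsets, and both properties are instances of concentration
   along a relation rho that is invariant under reindexing. *)
Require Import Defs.
From HB Require Import structures.
From mathcomp Require Import all_boot all_order all_algebra.
From mathcomp Require Import all_classical all_reals all_analysis.
From mathcomp Require Import zify ring lra.
Set Implicit Arguments.
Unset Strict Implicit.
Unset Printing Implicit Defensive.

Import Order.TTheory GRing.Theory Num.Theory.
Import numFieldNormedType.Exports.
Local Open Scope ring_scope.

(** * Ramsey's theorem for increasing sequences, and repeated extraction *)

Section Ramsey.
Local Open Scope nat_scope.

Lemma homo_ltn_comp (phi chi : nat -> nat) :
  {homo phi : x y / x < y} -> {homo chi : x y / x < y} ->
  {homo phi \o chi : x y / x < y}.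
Proof. by move=> hphi hchi x y /hchi /hphi. Qed.

Lemma homo_ltn_mono (phi : nat -> nat) :
  {homo phi : x y / x < y} -> {mono phi : x y / x < y}.
Proof. by move=> h; apply/leqW_mono/leq_mono. Qed.

Lemma sorted_map_homo (phi : nat -> nat) (s : seq nat) :
  {homo phi : x y / x < y} -> sorted ltn (map phi s) = sorted ltn s.
Proof.
move=> h; rewrite sorted_map; apply: eq_sorted => x y /=.
exact: homo_ltn_mono.
Qed.

Lemma unbounded_enum (c : nat -> Prop) :
  (forall a, exists b, a <= b /\ c b) ->
  exists phi, {homo phi : x y / x < y} /\ forall r, c (phi r).
Proof.
move=> /choice[g gP]; exists (fun r => iter r (g \o succn) (g 0)); split.
  by apply: homo_ltn => [x y z|i]; [exact: ltn_trans|case: (gP (iter i (g \o succn) (g 0)).+1)].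
by case=> [|r] /=; [case: (gP 0)|case: (gP (iter r (g \o succn) (g 0)).+1)].
Qed.

Lemma pigeonhole_enum (c : nat -> Prop) :
  exists phi, {homo phi : x y / x < y} /\
    ((forall r, c (phi r)) \/ (forall r, ~ c (phi r))).
Proof.
have [h|] := pselect (forall a, exists b, a <= b /\ c b).
  by have [phi [? ?]] := unbounded_enum h; exists phi; split => //; left.
move=> /existsNP[a /forallNP h]; exists (addn a); split.
  by move=> x y; rewrite ltn_add2l.
by right => r cr; apply: (h (a + r)); rewrite leq_addr.
Qed.

(** Induction on [K]: once the first entry is fixed, the colouring of the remaining ones is made
    homogeneous on a thinner enumeration. A diagonal enumeration treats all first entries at once,
    and the pigeonhole principle makes their colours agree. *)
Lemma ramsey (K : nat) (P : seq nat -> Prop) :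
  exists phi, {homo phi : x y / x < y} /\
    ((forall s, size s = K -> sorted ltn s -> P (map phi s)) \/
     (forall s, size s = K -> sorted ltn s -> ~ P (map phi s))).
Proof.
elim: K P => [|K IH] P.
  exists id; split => //.
  by have [p|p] := pselect (P [::]); [left|right] => s /size0nil ->.
(* [step psi] thins out the values of [psi] after [psi 0] so that the colour of a sequence starting
   at [psi 0] no longer depends on its other entries. *)
have /choice[step stepP] := fun psi : nat -> nat =>
  IH (fun s => P (psi 0 :: map (psi \o succn) s)).
pose psi_ q := iter q (fun psi => psi \o succn \o step psi) id.
have psiS q : psi_ q.+1 = psi_ q \o succn \o step (psi_ q) by [].
have psi_homo q : {homo psi_ q : x y / x < y}.
  elim: q => [//|q IHq]; rewrite psiS.
  apply: homo_ltn_comp (stepP _).1.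
  exact: (homo_ltn_comp (chi := succn)).
(* The diagonal: all values of [phi] after rank [r] lie in the range of [psi_ r.+1], which is
   already homogeneous for the first entry [phi r]. *)
pose phi r := psi_ r 0.
have phi_homo : {homo phi : x y / x < y}.
  apply: homo_ltn => [x y z|i]; first exact: ltn_trans.
  by rewrite /phi psiS /=; apply: psi_homo.
have psi_rg q r : q <= r -> forall x, exists y, psi_ r x = psi_ q y.
  move=> /subnK <-; elim: (r - q) => [|t IHt] x; first by exists x.
  have [y E] := IHt (step (psi_ (t + q)) x).+1.
  by exists y; rewrite -E.
have phi_tail r s : path ltn r s ->
    exists2 s', map phi s = map (psi_ r.+1) s' & size s' = size s /\ sorted ltn s'.
  move=> rs.
  have hs x : exists y, r < x -> phi x = psi_ r.+1 y.
    have [rx|_] := ltnP r x; last by exists 0.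
    by have [y E] := psi_rg _ _ rx 0; exists y.
  have [g gP] := choice hs.
  have E : map phi s = map (psi_ r.+1) (map g s).
    rewrite -map_comp; apply/eq_in_map => x xs; apply: gP.
    by move: rs => /(order_path_min ltn_trans) /allP; apply.
  exists (map g s) => //; rewrite size_map; split => //.
  rewrite -(sorted_map_homo _ (psi_homo r.+1)) -E (sorted_map_homo _ phi_homo).
  exact: path_sorted rs.
(* The colour of the first entry [phi r]. Where [c] fails, the choice of [step] leaves only the
   negative alternative. *)
pose c r := forall s, size s = K -> sorted ltn s ->
  P (psi_ r 0 :: map (psi_ r \o succn) (map (step (psi_ r)) s)).
have [chi [chi_homo hchi]] := pigeonhole_enum c.
exists (phi \o chi); split; first exact: homo_ltn_comp.
have split_s s : size s = K.+1 -> sorted ltn s ->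
    exists r s', [/\ map (phi \o chi) s = psi_ (chi r) 0 ::
      map (psi_ (chi r) \o succn) (map (step (psi_ (chi r))) s'),
      size s' = K & sorted ltn s'].
  case: s => // r s [sK] rs.
  have := phi_tail (chi r) (map chi s).
  rewrite path_map (eq_path (e' := ltn)); last by move=> x y /=; exact: homo_ltn_mono.
  move=> /(_ rs)[s' E [sz ss]]; exists r, s'; split => //; last by rewrite sz size_map.
  by rewrite /= map_comp E; congr cons; rewrite -map_comp psiS.
case: hchi => hc; [left|right] => s sK ss; have [r [s' [-> sz ss']]] := split_s s sK ss.
  exact: hc.
have [_ [h|h]] := stepP (psi_ (chi r)); last exact: h.
by case: (hc r) => ? ? ?; apply: h.
Qed.

End Ramsey.

(** Finitely many successive extractions: each [Q j] survives further reindexing, so later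
    extractions do not spoil earlier ones. *)
Lemma homo_subseq_iter (J : nat) (Q : nat -> (nat -> nat) -> Prop) :
  (forall j phi chi, {homo chi : x y / (x < y)%N} -> Q j phi -> Q j (phi \o chi)) ->
  (forall j phi, (j < J)%N -> {homo phi : x y / (x < y)%N} ->
     exists chi, {homo chi : x y / (x < y)%N} /\ Q j (phi \o chi)) ->
  exists phi, {homo phi : x y / (x < y)%N} /\ forall j, (j < J)%N -> Q j phi.
Proof.
move=> Qsub; elim: J => [|J IH] Qex; first by exists id; split.
have [phi [hphi Qphi]] := IH (fun j phi jJ => Qex j phi (ltnW jJ)).
have [chi [hchi Qchi]] := Qex J phi (ltnSn J) hphi.
exists (phi \o chi); split; first exact: homo_ltn_comp.
move=> j; rewrite ltnS leq_eqVlt => /orP[/eqP -> //|jJ].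
exact: Qsub (Qphi j jJ).
Qed.

Lemma sorted_ltn_cat (s1 s2 : seq nat) :
  sorted ltn (s1 ++ s2) = [&& allrel ltn s1 s2, sorted ltn s1 & sorted ltn s2].
Proof. by rewrite !(sorted_pairwise ltn_trans) pairwise_cat. Qed.

Lemma sorted_ltn_split (v : nat) (s : seq nat) : sorted ltn s ->
  exists u w, [/\ s = u ++ w, all (fun x => x < v)%N u & all (fun x => v <= x)%N w].
Proof.
elim: s => [|x s IH] /= xs; first by exists [::], [::].
have [xv|vx] := ltnP x v.
  have [u [w [-> au aw]]] := IH (path_sorted xs).
  by exists (x :: u), w; rewrite /= xv au.
exists [::], (x :: s); split => //=; rewrite vx /=.
by apply: sub_all (order_path_min ltn_trans xs) => y /ltnW; apply: leq_trans.
Qed.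

(** * Ramsey stabilisation and block structure *)

Section Stabilisation.
Variable R : realType.

(** The range is cut into [q] layers of height [delta]. From the top layer down, Ramsey decides
    whether the values all avoid the layer or all fall in it. *)
Lemma ramsey_real (K : nat) (g : seq nat -> R) (C delta : R) : 0 < delta ->
  (forall s, size s = K -> sorted ltn s -> 0 <= g s <= C) ->
  exists phi kappa, [/\ {homo phi : x y / (x < y)%N}, 0 <= kappa &
    forall s, size s = K -> sorted ltn s -> kappa - delta <= g (map phi s) <= kappa].
Proof.
move=> d0 gC.
have [q Cq] : exists q : nat, C <= q%:R * delta.
  exists (Num.bound `|C / delta|); rewrite -ler_pdivrMr //.
  exact: le_trans (ler_norm _) (ltW (archi_boundP (normr_ge0 _))).
have {gC} : forall s, size s = K -> sorted ltn s -> 0 <= g s <= q%:R * delta.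
  by move=> s sK ss; have /andP[h0 h1] := gC s sK ss; rewrite h0 (le_trans h1).
elim: q g {C Cq} => [|q IH] g gC.
  exists id, 0; split => // s sK ss; have := gC s sK ss; rewrite map_id; lra.
have [phi [hphi hP]] := ramsey K (fun s => g s <= q%:R * delta).
have ssphi s : sorted ltn s -> sorted ltn (map phi s) by rewrite sorted_map_homo.
case: hP => hP.
  have [|chi [kappa [hchi k0 hk]]] := IH (g \o map phi).
    move=> s sK ss /=; rewrite hP // andbT.
    by case/andP: (gC _ (etrans (size_map phi s) sK) (ssphi s ss)).
  exists (phi \o chi), kappa; split => //; first exact: homo_ltn_comp.
  by move=> s sK ss; rewrite map_comp; apply: hk.
exists phi, (q.+1%:R * delta); split => //; first by rewrite mulr_ge0 // ltW.
move=> s sK ss; have /andP[_ ->] := gC _ (etrans (size_map phi s) sK) (ssphi s ss).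
rewrite andbT; have /negP := hP s sK ss; rewrite -ltNge -natr1; nra.
Qed.

Variables (mu : seq nat -> nat -> R) (k : nat) (C delta : R).
Hypothesis mu_ge0 : forall s i, 0 <= mu s i.
Hypothesis mu_le : forall s B, size s = k -> sorted ltn s ->
  \sum_(0 <= i < B) mu s i <= C.
Hypothesis delta_gt0 : 0 < delta.

(* If the mass of a fixed gap were always larger than [delta], chopping that gap
   into many pieces would exceed the total mass [C]. *)
Lemma small_gaps : exists phi, {homo phi : x y / (x < y)%N} /\
  forall u a b w, size (u ++ w) = k -> sorted ltn (u ++ [:: a, b & w]) ->
    \sum_(phi a <= i < phi b) mu (map phi (u ++ w)) i <= delta.
Proof.
pose Q j (phi : nat -> nat) := forall u a b w, size u = j -> size (u ++ w) = k ->
  sorted ltn (u ++ [:: a, b & w]) ->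
  \sum_(phi a <= i < phi b) mu (map phi (u ++ w)) i <= delta.
suff [phi [hphi Qphi]] : exists phi, {homo phi : x y / (x < y)%N} /\
    forall j, (j < k.+1)%N -> Q j phi.
  exists phi; split => // u a b w uwk; apply: (Qphi (size u)) => //.
  by rewrite ltnS -uwk size_cat leq_addr.
apply: homo_subseq_iter => [j phi chi hchi Qj u a b w uj uwk ss|j phi jk hphi].
  rewrite map_comp map_cat; apply: Qj; rewrite ?size_map -?map_cat ?size_map //.
  by rewrite -[_ :: _ :: _]/(map chi [:: a, b & w]) -map_cat sorted_map_homo.
pose I (u : seq nat) a b w := \sum_(phi a <= i < phi b) mu (map phi (u ++ w)) i.
(* A sequence of length k + 2 encodes one of length [k] together with a test interval, whose
   endpoints sit at ranks [j] and [j + 1]. The default [0] is never reached at this length. *)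
pose P t := I (take j t) (nth 0%N (drop j t) 0) (nth 0%N (drop j t) 1) (drop 2 (drop j t)) <= delta.
have PE chi u a b w : size u = j ->
    P (map chi (u ++ [:: a, b & w])) = (I (map chi u) (chi a) (chi b) (map chi w) <= delta).
  by move=> uj; rewrite /P map_cat take_size_cat ?drop_size_cat ?size_map //= drop0.
have [chi [hchi hP]] := ramsey k.+2 P.
exists chi; split => //; case: hP => [hP u a b w uj uwk ss|hP].
  have := hP (u ++ [:: a, b & w]); rewrite PE // map_comp map_cat; apply => //.
  by rewrite size_cat /= !addnS -size_cat uwk.
exfalso.
have hC0 : 0 <= C.
  have := mu_le 0 (size_iota 0 k) (iota_ltn_sorted 0 k).
  by rewrite big_geq.
(* In the unfavourable case, the [n] adjacent intervals with endpoints [j, ..., j + n] lie in one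
   gap between [u] and [w] and each has mass more than [delta], while [C < n * delta]. *)
pose n := Num.bound (C / delta).
have Cn : C < n%:R * delta.
  by rewrite -ltr_pdivrMr //; apply: archi_boundP; rewrite divr_ge0 // ltW.
pose u := iota 0 j; pose w := iota (j + n.+1) (k - j).
pose psi := phi \o chi.
have hpsi : {homo psi : x y / (x < y)%N} by exact: homo_ltn_comp.
have uwk : size (u ++ w) = k by rewrite size_cat !size_iota subnKC.
have key q : (q <= n)%N ->
    q%:R * delta <= \sum_(psi j <= i < psi (j + q)%N) mu (map psi (u ++ w)) i.
  elim: q => [|q IHq] qn; first by rewrite mul0r addn0 big_geq.
  rewrite (@big_cat_nat _ _ _ (psi (j + q)%N)) /=; first last.
  - by apply/ltnW/hpsi; rewrite addnS.
  - by rewrite (leq_mono hpsi) leq_addr.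
  rewrite -natr1 mulrDl mul1r lerD ?IHq 1?ltnW //.
  have := hP (u ++ [:: (j + q)%N, (j + q.+1)%N & w]).
  rewrite PE ?size_iota // /I -map_cat -map_comp => hlt; apply: ltW; rewrite ltNge.
  apply/negP; apply: hlt.
    by rewrite size_cat /= !addnS -size_cat uwk.
  rewrite sorted_ltn_cat iota_ltn_sorted /=; apply/andP; split.
    apply/allrelP => x y; rewrite !inE !mem_iota => hx.
    by move=> /orP[/eqP->|/orP[/eqP->|hy]]; lia.
  rewrite addnS ltnSn /=; rewrite (path_sortedE ltn_trans) iota_ltn_sorted andbT.
  by apply/allP => y; rewrite mem_iota; lia.
have := key n (leqnn n); apply/negP; rewrite -ltNge; apply: le_lt_trans Cn.
apply: le_trans (mu_le (psi (j + n)%N) (s := map psi (u ++ w)) _ _).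
- rewrite [leRHS](@big_cat_nat _ _ _ (psi j)) //=; last first.
    by rewrite (leq_mono hpsi) leq_addr.
  by rewrite lerDr sumr_ge0.
- by rewrite size_map.
- rewrite sorted_map_homo // sorted_ltn_cat !iota_ltn_sorted !andbT.
  by apply/allrelP => x y; rewrite !mem_iota; lia.
Qed.

(** Every third value of the small-gap enumeration is used: [v] goes to rank 3v + 3, and its block
    runs from rank 3v + 2 to rank 3v + 4. The block of an absent [v] then lies in a gap of the
    sequence, and so does each of the k + 1 intervals left around the blocks of the entries. *)
Lemma block_structure : exists (psi lo hi : nat -> nat) (N : nat),
  [/\ {homo psi : x y / (x < y)%N},
      forall v, (N <= lo v <= hi v)%N,
      forall s v, size s = k -> sorted ltn s -> v \notin s ->
        \sum_(lo v <= i < hi v) mu (map psi s) i <= delta &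
      forall s B, size s = k -> sorted ltn s ->
        \sum_(N <= i < B) mu (map psi s) i <=
          \sum_(v <- s) \sum_(lo v <= i < hi v) mu (map psi s) i + k.+1%:R * delta].
Proof.
have [phi [hphi gap]] := small_gaps.
have mphi : {mono phi : x y / (x <= y)%N} by exact: leq_mono.
pose T v := (3 * v + 3)%N.
have hT : {homo T : x y / (x < y)%N} by move=> x y; rewrite /T; lia.
pose lo v := phi (3 * v + 2)%N; pose hi v := phi (3 * v + 4)%N.
have gapT s u a b w : size s = k -> sorted ltn s -> s = u ++ w ->
    all (fun x => T x < a)%N u -> all (fun x => b < T x)%N w -> (a < b)%N ->
    \sum_(phi a <= i < phi b) mu (map (phi \o T) s) i <= delta.
  move=> sk ss E hu hw ab; rewrite map_comp E map_cat; apply: gap.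
    by rewrite -map_cat size_map -E.
  rewrite sorted_ltn_cat sorted_map_homo //.
  move: ss; rewrite E sorted_ltn_cat => /and3P[_ -> sw] /=.
  have hw' : all (fun x => b < x)%N (map T w) by rewrite all_map.
  rewrite ab (path_sortedE ltn_trans) sorted_map_homo // sw hw' /= !andbT.
  apply/allrelP => x y /mapP[x' /(allP hu) hx ->]; rewrite !inE => hy.
  apply: leq_trans hx _; case/orP: hy => [/eqP-> //|/orP[/eqP->|/(allP hw') /ltnW by_]].
    exact: ltnW.
  exact: leq_trans (ltnW ab) by_.
exists (phi \o T), lo, hi, (phi 0%N); split.
- exact: homo_ltn_comp.
- by move=> v; rewrite /lo /hi !mphi; lia.
- move=> s v sk ss vs; have [u [w [E au aw]]] := sorted_ltn_split v ss.
  apply: (gapT s u _ _ w) => //; last by lia.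
    by apply: sub_all au => x; rewrite /T; lia.
  apply/allP => y yw; have : y != v.
    by apply: contra vs => /eqP <-; rewrite E mem_cat yw orbT.
  by have := allP aw _ yw; rewrite /T /=; lia.
move=> s B sk ss.
(* Induction on the entries [w] still to come, [a] being the rank reached: each step pays for one
   small interval and then for one block. *)
have key b w : forall u a, s = u ++ w -> all (fun x => T x < a)%N u ->
    all (fun x => a <= 3 * x + 2)%N w -> all (fun x => 3 * x + 4 < b)%N w -> (a < b)%N ->
    \sum_(phi a <= i < phi b) mu (map (phi \o T) s) i <=
    \sum_(v <- w) \sum_(lo v <= i < hi v) mu (map (phi \o T) s) i + (size w).+1%:R * delta.
  elim: w => [|v w IHw] u a E hu hw hb ab.
    rewrite big_nil add0r mul1r; exact: (gapT s u _ _ [::]).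
  case/andP: hw => av hw; case/andP: hb => vb hb.
  have hu' : all (fun x => T x < 3 * v + 4)%N (rcons u v).
    rewrite all_rcons /T; apply/andP; split; first by lia.
    by apply: sub_all hu => x /=; rewrite /T; lia.
  have sE : s = rcons u v ++ w by rewrite cat_rcons.
  have vw : all (fun x => v < x)%N w.
    move: ss; rewrite E sorted_ltn_cat => /and3P[_ _ /=].
    by rewrite (path_sortedE ltn_trans) => /andP[].
  have hw' : all (fun x => 3 * v + 4 <= 3 * x + 2)%N w.
    by apply: sub_all vw => x /=; lia.
  have := IHw _ _ sE hu' hw' hb vb.
  rewrite big_cons (@big_cat_nat _ _ _ (lo v) (phi a)) /=; first last.
  - by rewrite mphi; lia.
  - by rewrite mphi.
  rewrite (@big_cat_nat _ _ _ (hi v) (lo v)) /=; first last.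
  - by rewrite mphi; lia.
  - by rewrite mphi; lia.
  rewrite -[(size w).+2%:R]natr1 mulrDl mul1r => IH.
  have small : \sum_(phi a <= i < lo v) mu (map (phi \o T) s) i <= delta.
    have [->|nav] := eqVneq a (3 * v + 2)%N; first by rewrite big_geq // ltW.
    apply: (gapT s u _ _ (v :: w)) => //; last by lia.
    rewrite /= /T; apply/andP; split; first by lia.
    by apply: sub_all vw => x /=; lia.
  move: IH small; rewrite /hi; lra.
(* The last rank [b] lies beyond [B] and all blocks; enlarging the range only adds nonnegative
   terms. *)
have [b [Bb hb]] : exists b, (B < b)%N /\ all (fun x => 3 * x + 4 < b)%N s.
  elim: s {sk ss key} => [|x s [b [Bb hb]]]; first by exists B.+1.
  exists (b + (3 * x + 5))%N; split; first by lia.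
  by rewrite /=; apply/andP; split; [lia|apply: sub_all hb => y /=; lia].
have Bphi : (B <= phi b)%N.
  apply: leq_trans (ltnW Bb) _; elim: (b) => // n IHn.
  by apply: leq_ltn_trans IHn _; apply: hphi.
have := key b s [::] 0%N erefl isT (introT allP (fun _ _ => isT)) hb (leq_ltn_trans (leq0n B) Bb).
rewrite sk; apply: le_trans.
have [B0|B0] := leqP B (phi 0%N); first by rewrite big_geq // sumr_ge0.
rewrite [leRHS](@big_cat_nat _ _ _ B) //= ?lerDl ?sumr_ge0 //.
exact: ltnW.
Qed.

End Stabilisation.

(** * Norms in lp sums *)

Section PowerInequalities.
Variable R : realType.
Implicit Types a b p : R.

(** Either [b <= t * a], and [a + b <= (1 + t) * a], or [a + b <= (1 + t^-1) * b]. For small [t] the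
    main term [a] is multiplied by a factor close to 1. *)
Lemma powR_add_le a b p t : 0 <= a -> 0 <= b -> 0 <= p -> 0 < t ->
  (a + b) `^ p <= (1 + t) `^ p * a `^ p + (1 + t^-1) `^ p * b `^ p.
Proof.
move=> a0 b0 p0 t0; have tV : 0 < t^-1 by rewrite invr_gt0.
have t1 : 0 <= 1 + t by rewrite addr_ge0 // ltW.
have tV1 : 0 <= 1 + t^-1 by rewrite addr_ge0 // ltW.
rewrite -!powRM //.
have [bta|atb] := leP b (t * a).
  apply: (@le_trans _ _ (((1 + t) * a) `^ p)).
    by apply: ge0_ler_powR; rewrite ?nnegrE ?mulr_ge0 ?addr_ge0 //; nra.
  by rewrite lerDl powR_ge0.
have atb' : a <= t^-1 * b by rewrite mulrC ler_pdivlMr // mulrC ltW.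
apply: (@le_trans _ _ (((1 + t^-1) * b) `^ p)).
  by apply: ge0_ler_powR; rewrite ?nnegrE ?mulr_ge0 ?addr_ge0 //; nra.
by rewrite lerDr powR_ge0.
Qed.

(** Convexity of the power at the midpoint. When both terms obey the same bound, the total cost is 2
    to the power [p], which [lam >= 2] absorbs. *)
Lemma powR_add_le_convex a b p : 0 <= a -> 0 <= b -> 1 <= p ->
  (a + b) `^ p <= 2 `^ p * ((a `^ p + b `^ p) / 2).
Proof.
move=> a0 b0 p1; have ab0 := addr_ge0 a0 b0.
have h1 : 0 <= 2^-1 :> R by rewrite invr_ge0.
have h2 : 2^-1 <= 1 :> R by rewrite invf_le1 ?ler1n.
have e : unstable.onem 2^-1 = 2^-1 :> R by rewrite /unstable.onem; lra.
have h : (2^-1 * a + unstable.onem 2^-1 * b) `^ p <=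
    2^-1 * a `^ p + unstable.onem 2^-1 * b `^ p.
  by apply: (convex_powR p1 (Itv01 h1 h2)); rewrite inE /= in_itv /= ?a0 ?b0.
move: h; rewrite e -!mulrDr => h.
have -> : a + b = 2 * (2^-1 * (a + b)) by rewrite mulrA mulfV ?mul1r // pnatr_eq0.
rewrite powRM ?mulr_ge0 // ler_wpM2l ?powR_ge0 //.
by rewrite [leRHS]mulrC.
Qed.

End PowerInequalities.

Section LpSum.
Variables (R : realType) (X : nat -> completeNormedModType R) (p : R).
Hypothesis p1 : 1 < p.
Implicit Types x y : lp_sum X p.

(** [lp_dist] is defined through [limn], which is informative only once convergence is known. *)
Lemma lp_dist_summable x y :
  cvgn (series (fun n => `|lp_val x n - lp_val y n| `^ p)).
Proof.
apply: (@series_le_cvg _ _ (fun n => 2 `^ p * ((`|lp_val x n| `^ p + `|lp_val y n| `^ p) / 2))).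
- by move=> n; apply: powR_ge0.
- by move=> n; rewrite mulr_ge0 ?divr_ge0 ?addr_ge0 ?powR_ge0.
- move=> n; apply: le_trans (powR_add_le_convex _ _ (ltW p1)) => //.
  apply: ge0_ler_powR; rewrite ?nnegrE ?addr_ge0 ?ler_normB //.
  exact: le_trans ler01 (ltW p1).
rewrite (_ : (fun n => _) = (2 `^ p / 2) *:
    ((fun n => `|lp_val x n| `^ p) + (fun n => `|lp_val y n| `^ p))).
  exact/is_cvg_seriesZ/is_cvg_seriesD/lp_valP/lp_valP.
apply/funext => n.
rewrite -[RHS]/(2 `^ p / 2 * (`|lp_val x n| `^ p + `|lp_val y n| `^ p)).
by rewrite -mulrA [2^-1 * _]mulrC.
Qed.

Lemma lp_dist_powR x y :
  lp_dist x y `^ p = limn (series (fun n => `|lp_val x n - lp_val y n| `^ p)).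
Proof.
rewrite /lp_dist -powRrM mulVf ?gt_eqF ?(lt_trans ltr01 p1) // powRr1 //.
apply: limr_ge; first exact: lp_dist_summable.
by apply: nearW => n; apply: sumr_ge0 => i _; apply: powR_ge0.
Qed.

Lemma lp_dist_partial x y (B : nat) :
  \sum_(0 <= i < B) `|lp_val x i - lp_val y i| `^ p <= lp_dist x y `^ p.
Proof.
rewrite lp_dist_powR; apply: nondecreasing_cvgn_le B; last exact: lp_dist_summable.
by apply: nondecreasing_series => i _ _; apply: powR_ge0.
Qed.

(** Together with [lp_dist_partial], this reduces all norm estimates to finite sums of p-th
    powers. *)
Lemma lp_dist_le x y (c : R) : 0 <= c ->
  (forall B : nat, \sum_(0 <= i < B) `|lp_val x i - lp_val y i| `^ p <= c `^ p) ->
  lp_dist x y <= c.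
Proof.
move=> c0 h.
have : limn (series (fun n => `|lp_val x n - lp_val y n| `^ p)) <= c `^ p.
  by apply: limr_le; [exact: lp_dist_summable|apply: nearW => B; apply: h].
rewrite -lp_dist_powR => hle; rewrite leNgt; apply/negP => cd.
have := @gt0_ltr_powR R p _ c (lp_dist x y); rewrite !nnegrE powR_ge0.
by move=> /(_ (lt_trans ltr01 p1) c0 isT cd); rewrite ltNge hle.
Qed.
End LpSum.

(** * Concentration along a reindexing-invariant relation *)

Lemma incrP (k : nat) (n : k.-tuple nat) :
  incr n <-> forall i j : 'I_k, (i < j)%N -> (tnth n i < tnth n j)%N.
Proof.
rewrite /incr (sorted_pairwise ltn_trans); split.
  move=> /(pairwiseP 0%N) h i j ij; rewrite !(tnth_nth 0%N).
  by apply: h; rewrite ?inE ?size_tuple.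
move=> h; apply/(pairwiseP 0%N) => i j; rewrite !inE size_tuple => ik jk ij.
by have := h (Ordinal ik) (Ordinal jk) ij; rewrite !(tnth_nth 0%N).
Qed.

Lemma incr_map (k : nat) (phi : nat -> nat) (n : k.-tuple nat) :
  {homo phi : x y / (x < y)%N} -> incr (map_tuple phi n) = incr n.
Proof. by move=> h; apply: sorted_map_homo. Qed.

Lemma tuple_split (k : nat) (n : k.-tuple nat) (j : 'I_k) :
  n = take j n ++ tnth n j :: drop j.+1 n :> seq nat.
Proof. by rewrite (tnth_nth 0%N) -drop_nth ?size_tuple // cat_take_drop. Qed.

(** Merging the two tuples turns a pair in [Hrel] into one increasing sequence of length k + 1, the
    form to which Ramsey applies. *)
Lemma HrelP (k : nat) (j : 'I_k) (n m : k.-tuple nat) :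
  Hrel j n m <-> exists u x y w, [/\ n = u ++ x :: w :> seq nat,
    m = u ++ y :: w :> seq nat, size u = j & sorted ltn (u ++ [:: x, y & w])].
Proof.
split.
  case=> incn [incm [nm xy]].
  have szu : size (take j n) = j by rewrite size_takel // size_tuple ltnW.
  have nth_nm i : (i < k)%N -> i != j :> nat -> nth 0%N n i = nth 0%N m i.
    by move=> ik ij; have := nm (Ordinal ik) ij; rewrite !(tnth_nth 0%N).
  have tk : take j m = take j n.
    apply: (@eq_from_nth _ 0%N); rewrite ?szu ?size_takel ?size_tuple ?(ltnW (ltn_ord j)) //.
    move=> i ij; rewrite !nth_take // nth_nm ?(ltn_trans ij) //.
    by rewrite neq_ltn ij.
  have dr : drop j.+1 m = drop j.+1 n.
    apply: (@eq_from_nth _ 0%N); rewrite ?size_drop ?size_tuple // => i ij.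
    by rewrite !nth_drop nth_nm; lia.
  exists (take j n), (tnth n j), (tnth m j), (drop j.+1 n); split => //.
  - exact: tuple_split.
  - by rewrite {1}(tuple_split m j) tk dr.
  - move: incn incm; rewrite /incr (tuple_split n j) (tuple_split m j) tk dr.
    rewrite -tuple_split => h.
    have : sorted ltn (take j n ++ tnth n j :: drop j.+1 n) by rewrite -tuple_split.
    rewrite !sorted_ltn_cat !allrel_consr /= xy => /and3P[/andP[-> ->] -> _].
    by case/and3P => /andP[-> _] _ ->.
case=> u [x [y [w [En Em szu]]]].
rewrite sorted_ltn_cat !allrel_consr /= => /and3P[/and3P[ux uy uw] su /andP[xy yw]].
have sy : sorted ltn (y :: w) by [].
move: (sy); rewrite /= (path_sortedE ltn_trans) => /andP[ayw sw].
split; last split; last split.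
- rewrite /incr En sorted_ltn_cat allrel_consr ux uw su /= (path_sortedE ltn_trans) sw andbT.
  by apply: sub_all ayw => z /=; apply: ltn_trans.
- by rewrite /incr Em sorted_ltn_cat allrel_consr uy uw su.
- move=> i ij; rewrite !(tnth_nth 0%N) En Em !nth_cat szu; case: ltnP => // ji.
  have : (0 < i - j)%N by rewrite subn_gt0 ltn_neqAle ji andbT eq_sym.
  by case: (i - j)%N.
by rewrite !(tnth_nth 0%N) En Em !nth_cat szu ltnn subnn.
Qed.

(* Both tuples are deformed, last entry first, into a common block of consecutive
   large integers. *)
Lemma Hrel_invariant_const (k : nat) (T : Type) (f : k.-tuple nat -> T) :
  (forall j n m, Hrel j n m -> f n = f m) ->
  forall n m, incr n -> incr m -> f n = f m.
Proof.
move=> fH.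
(* The first [r] entries of [n] followed by large integers: lowering [r] by one moves a single
   entry, upwards. *)
pose hyb B (n : k.-tuple nat) r := [tuple (if (i < r)%N then tnth n i else B + i)%N | i < k].
have deform B n : incr n -> (forall i, tnth n i < B)%N -> f n = f (hyb B n 0%N).
  move=> /incrP incn nB.
  have hyb_incr r : incr (hyb B n r).
    apply/incrP => i j ij; rewrite !tnth_mktuple.
    by have := incn i j ij; have := nB i; case: ifP; case: ifP; lia.
  have -> : n = hyb B n k by apply: eq_from_tnth => i; rewrite tnth_mktuple ltn_ord.
  have : (k <= k)%N by []; elim: {1 3}k => // r IHr rk.
  rewrite -IHr ?(ltnW rk) //; apply: (fH (Ordinal rk)); split; last split; last split.
  - exact: hyb_incr.
  - exact: hyb_incr.
  - move=> i; rewrite -val_eqE /= !tnth_mktuple => ir.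
    by rewrite ltnS leq_eqVlt (negPf ir).
  - by rewrite !tnth_mktuple /= ltnSn ltnn; apply: leq_trans (nB _) (leq_addr _ _).
have bnd (n : k.-tuple nat) B i : (\sum_(j < k) tnth n j < B)%N -> (tnth n i < B)%N.
  by apply: leq_ltn_trans; rewrite (bigD1 i) //= leq_addr.
move=> n m incn incm.
pose B := (\sum_(j < k) tnth n j + \sum_(j < k) tnth m j).+1%N.
rewrite (deform B n) ?(deform B m) //.
- by move=> i; apply: bnd; rewrite ltnS leq_addl.
- by move=> i; apply: bnd; rewrite ltnS leq_addr.
Qed.

Section Lipschitz.
Variables (R : realType) (T : Type) (d : T -> T -> R) (k : nat) (f : k.-tuple nat -> T).

Lemma le_Lipj (j : 'I_k) n m : bounded_on_incr d f -> Hrel j n m ->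
  d (f n) (f m) <= Lipj d f j.
Proof.
move=> [C hC] nm; apply: ub_le_sup; last by exists n, m.
by exists C => _ [n' [m' [[in' [im' _]] ->]]]; apply: hC.
Qed.

Lemma Lipj_le (j : 'I_k) (c : R) : 0 <= c ->
  (forall n m, Hrel j n m -> d (f n) (f m) <= c) -> Lipj d f j <= c.
Proof.
move=> c0 hc; rewrite /Lipj; set A := (X in sup X).
have [->|/set0P A0] := eqVneq A set0; first by rewrite sup0.
by apply: ge_sup => // _ [n [m [nm ->]]]; apply: hc.
Qed.

Lemma Lipj_ge0 (j : 'I_k) : (forall x y, 0 <= d x y) -> bounded_on_incr d f ->
  0 <= Lipj d f j.
Proof.
move=> d0 bf; rewrite /Lipj; set A := (X in sup X).
have [->|/set0P[_ [n [m [nm _]]]]] := eqVneq A set0; first by rewrite sup0.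
exact: le_trans (d0 _ _) (le_Lipj bf nm).
Qed.

End Lipschitz.

Section Concentration.
Variable R : realType.
Variable rho : forall k : nat, k.-tuple nat -> k.-tuple nat -> Prop.

Definition reindexing_invariant := forall (k : nat) (phi : nat -> nat) (n m : k.-tuple nat),
  {homo phi : x y / (x < y)%N} ->
  rho (map_tuple phi n) (map_tuple phi m) <-> rho n m.

Definition concentrates (T : Type) (d : T -> T -> R) (lam p : R) :=
  forall (k : nat) (f : k.-tuple nat -> T), bounded_on_incr d f ->
  exists phi : nat -> nat, {homo phi : x y / (x < y)%N} /\
    forall n m : k.-tuple nat, incr n -> incr m -> rho n m ->
      d (f (map_tuple phi n)) (f (map_tuple phi m)) <= lam * Lip_bound d p f.

(** The range of an increasing map is infinite, and every infinite set of integers contains such a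
    range; invariance carries [rho] between tuples and their images. *)
Lemma concentratesP (T : Type) (d : T -> T -> R) (lam p : R) : reindexing_invariant ->
  concentrates d lam p <->
  forall (k : nat) (f : k.-tuple nat -> T), bounded_on_incr d f ->
    exists M : set nat, ~ finite_set M /\ forall n m, in_incr M n -> in_incr M m ->
      rho n m -> d (f n) (f m) <= lam * Lip_bound d p f.
Proof.
move=> rhoI; split=> conc k f /conc.
  move=> [phi [hphi hf]]; exists (range phi); split.
    have phi_inj : injective phi by apply: incn_inj; exact: leq_mono.
    rewrite (eq_finite_set (inj_card_eq _)); last by move=> x y _ _; apply: phi_inj.
    exact: infinite_nat.
  have pull (n : k.-tuple nat) : in_incr (range phi) n ->
      exists2 n', n = map_tuple phi n' & incr n'.
    move=> [incn hn].
    have /choice[g gP] : forall j : 'I_k, exists x, phi x = tnth n j.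
      by move=> j; have [x _ <-] := hn j; exists x.
    have E : n = map_tuple phi (mktuple g).
      by apply: eq_from_tnth => j; rewrite tnth_map tnth_mktuple gP.
    by exists (mktuple g) => //; rewrite E incr_map in incn.
  move=> n m /pull[n' -> in'] /pull[m' -> im'] /(rhoI _ _ _ _ hphi).
  exact: hf.
move=> [M [Minf hM]].
have [phi [hphi Mphi]] : exists phi, {homo phi : x y / (x < y)%N} /\ forall r, M (phi r).
  apply: unbounded_enum => a; apply: contrapT => /forallNP h; apply: Minf.
  apply: (@sub_finite_set _ _ `I_a); last exact: finite_II.
  by move=> b Mb /=; rewrite ltnNge; apply/negP => ab; apply: (h b).
exists phi; split => // n m incn incm /(rhoI _ _ _ _ hphi); apply: hM.
  by split; [rewrite incr_map|move=> j; rewrite tnth_map].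
by split; [rewrite incr_map|move=> j; rewrite tnth_map].
Qed.

End Concentration.

Lemma sorted_ltn_del (u w : seq nat) (x y : nat) : sorted ltn (u ++ [:: x, y & w]) ->
  sorted ltn (u ++ x :: w) /\ sorted ltn (u ++ y :: w).
Proof.
move=> h; split; apply: (subseq_sorted ltn_trans _ h); apply: cat_subseq => //.
  by rewrite /= eqxx; apply: subseq_cons.
exact: subseq_cons.
Qed.

Lemma Lip_bound_powR (R : realType) (T : Type) (d : T -> T -> R) (p : R) (k : nat)
    (f : k.-tuple nat -> T) : 0 < p ->
  Lip_bound d p f `^ p = \sum_(j < k) Lipj d f j `^ p.
Proof.
move=> p0; rewrite /Lip_bound -powRrM mulVf ?gt_eqF // powRr1 //.
by apply: sumr_ge0 => j _; apply: powR_ge0.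
Qed.

(** * Stabilisation of a single coordinate *)

Section Coordinate.
Variables (R : realType) (rho : forall k : nat, k.-tuple nat -> k.-tuple nat -> Prop).
Variables (V : normedModType R) (lam p : R) (k : nat) (h : seq nat -> V) (C delta : R).
Hypotheses (p0 : 0 < p) (lam0 : 0 <= lam) (delta0 : 0 < delta).
Hypothesis hC : forall s, size s = k -> sorted ltn s -> `|h s| <= C.
Hypothesis conc : concentrates rho (@normdist R V) lam p.

(* Ramsey makes the oscillation in each variable nearly constant, equal to some
   [kappa j]: it is then controlled from below as well as from above. *)
Lemma coordinate_concentration : exists (phi : nat -> nat) (kappa : nat -> R),
  [/\ {homo phi : x y / (x < y)%N},
      forall j : 'I_k, 0 <= kappa j,
      forall u x y w, size (u ++ x :: w) = k -> sorted ltn (u ++ [:: x, y & w]) ->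
        kappa (size u) - delta <=
          `|h (map phi (u ++ x :: w)) - h (map phi (u ++ y :: w))| `^ p &
      forall n m : k.-tuple nat, incr n -> incr m -> rho n m ->
        `|h (map phi n) - h (map phi m)| `^ p <= lam `^ p * \sum_(j < k) kappa j].
Proof.
have dist_le s t : size s = k -> size t = k -> sorted ltn s -> sorted ltn t ->
    `|h s - h t| <= C + C.
  by move=> sk tk ss st; apply: le_trans (ler_normB _ _) _; rewrite lerD ?hC.
pose D (phi : nat -> nat) u x y w :=
  `|h (map phi (u ++ x :: w)) - h (map phi (u ++ y :: w))| `^ p.
pose Q j phi := exists kappa, 0 <= kappa /\ forall u x y w, size u = j ->
  size (u ++ x :: w) = k -> sorted ltn (u ++ [:: x, y & w]) ->
  kappa - delta <= D phi u x y w <= kappa.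
have [phi [hphi Qphi]] : exists phi, {homo phi : x y / (x < y)%N} /\
    forall j, (j < k)%N -> Q j phi.
  apply: homo_subseq_iter => [j phi chi hchi [kappa [k0 hk]]|j phi jk hphi].
    exists kappa; split => // u x y w uj uwk ss.
    have := hk (map chi u) (chi x) (chi y) (map chi w).
    rewrite size_map -![chi _ :: map chi _]map_cons -!map_cat size_map sorted_map_homo //.
    by rewrite /D -!map_cons -!map_cat -!map_comp; apply.
  (* The oscillation in variable [j] is a function of one sequence of length k + 1, with the two
     competing entries at ranks [j] and [j + 1]. *)
  pose g t := D phi (take j t) (nth 0%N (drop j t) 0) (nth 0%N (drop j t) 1)
    (drop 2 (drop j t)).
  have gE (chi : nat -> nat) u x y w : size u = j ->
      g (map chi (u ++ [:: x, y & w])) = D phi (map chi u) (chi x) (chi y) (map chi w).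
    by move=> uj; rewrite /g map_cat take_size_cat ?drop_size_cat ?size_map //= drop0.
  have g_bound t : size t = k.+1 -> sorted ltn t -> 0 <= g t <= (C + C) `^ p.
    move=> tk; rewrite -(cat_take_drop j t).
    have : (1 < size (drop j t))%N by rewrite size_drop tk; lia.
    have : size (take j t) = j by rewrite size_takel // tk; lia.
    have := congr1 size (cat_take_drop j t); rewrite tk size_cat.
    move: (take j t) (drop j t) => u [|x [|y w]] //= szs uj _ ss.
    rewrite -[u ++ _]map_id gE // !map_id /D powR_ge0 /=.
    have [sx sy] := sorted_ltn_del ss.
    have dl : `|h (map phi (u ++ x :: w)) - h (map phi (u ++ y :: w))| <= C + C.
      by apply: dist_le; rewrite ?size_map ?sorted_map_homo // size_cat /=; lia.
    by apply: ge0_ler_powR; rewrite ?nnegrE ?(ltW p0) //; apply: le_trans dl.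
  have [chi [kappa [hchi k0 hk]]] := ramsey_real delta0 g_bound.
  exists chi; split => //; exists kappa; split => // u x y w uj uwk ss.
  have := hk (u ++ [:: x, y & w]); rewrite gE // /D -!map_cons -!map_cat -!map_comp.
  by apply => //; move: uwk; rewrite !size_cat /=; lia.
have /choice[kappa kP] : forall j, exists kap, (j < k)%N -> 0 <= kap /\
    forall u x y w, size u = j ->
    size (u ++ x :: w) = k -> sorted ltn (u ++ [:: x, y & w]) ->
    kap - delta <= D phi u x y w <= kap.
  move=> j; case: (ltnP j k) => [jk|_]; last by exists 0.
  by have [kap ?] := Qphi j jk; exists kap.
(* By Ramsey the p-th power of the oscillation of this [f] in variable [j] is at most [kappa j], so
   the property of [V] yields a bound in terms of the sum of the [kappa j]. *)
pose f (n : k.-tuple nat) := h (map phi n).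
have bf : bounded_on_incr (@normdist R V) f.
  by exists (C + C) => n m incn incm; apply: dist_le;
    rewrite ?size_map ?size_tuple ?sorted_map_homo.
have [chi [hchi hf]] := conc bf.
exists (phi \o chi), kappa; split.
- exact: homo_ltn_comp.
- by move=> j; have [] := kP j (ltn_ord j).
- move=> u x y w uwk ss.
  have jk : (size u < k)%N by rewrite -uwk size_cat /= addnS ltnS leq_addr.
  have [_ /(_ (map chi u) (chi x) (chi y) (map chi w))] := kP _ jk.
  rewrite size_map -![chi _ :: map chi _]map_cons -!map_cat size_map sorted_map_homo //.
  rewrite /D -!map_cons -!map_cat -!map_comp => hk.
  by case/andP: (hk erefl uwk ss).
move=> n m incn incm nm; have := hf n m incn incm nm.
rewrite /f /normdist /= -!map_comp => hle.
have LB0 : 0 <= Lip_bound (@normdist R V) p f by apply: powR_ge0.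
apply: le_trans (ge0_ler_powR (ltW p0) _ _ hle) _; rewrite ?nnegrE ?mulr_ge0 //.
rewrite powRM // Lip_bound_powR // ler_wpM2l ?powR_ge0 //.
apply: ler_sum => j _; have [kj0 hk] := kP j (ltn_ord j).
have Lk : Lipj (@normdist R V) f j <= kappa j `^ p^-1.
  apply: Lipj_le; first exact: powR_ge0.
  move=> n' m' /HrelP[u [x [y [w [En Em uj ss]]]]].
  have uwk : size (u ++ x :: w) = k by rewrite -En size_tuple.
  have /andP[_] := hk u x y w uj uwk ss; rewrite /D -En -Em => hD.
  have pV0 : 0 <= p^-1 by rewrite invr_ge0 ltW.
  have := ge0_ler_powR pV0 _ _ hD; rewrite -powRrM mulfV ?gt_eqF // powRr1 //.
  by apply; rewrite nnegrE ?powR_ge0.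
have := ge0_ler_powR (ltW p0) _ _ Lk; rewrite -powRrM mulVf ?gt_eqF // powRr1 //.
by apply; rewrite ?nnegrE ?powR_ge0 //; apply: Lipj_ge0 bf => ? ?; apply: normr_ge0.
Qed.

End Coordinate.

(** * Head and block estimates in the lp sum *)

Section LpConcentration.
Variables (R : realType) (X : nat -> completeNormedModType R) (p lam : R).
Variable rho : forall k : nat, k.-tuple nat -> k.-tuple nat -> Prop.
Hypotheses (p1 : 1 < p) (lam2 : 2 <= lam) (rhoI : reindexing_invariant rho).
Hypothesis conc : forall n, concentrates rho (@normdist R (X n)) lam p.
Variables (k : nat) (f : k.-tuple nat -> lp_sum X p).
Hypothesis bf : bounded_on_incr (@lp_dist R X p) f.

Let p0 : 0 < p. Proof. exact: lt_trans ltr01 p1. Qed.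
Let lam0 : 0 <= lam. Proof. exact: le_trans (ler0n _ 2) lam2. Qed.
Let L j := Lipj (@lp_dist R X p) f j.

Lemma lp_dist_ge0 (x y : lp_sum X p) : 0 <= lp_dist x y.
Proof. exact: powR_ge0. Qed.

Lemma Lipj_lp_ge0 j : 0 <= L j.
Proof. by apply: Lipj_ge0 bf; apply: lp_dist_ge0. Qed.

Lemma partial_le_Lipj j n m (B : nat) : Hrel j n m ->
  \sum_(0 <= i < B) `|lp_val (f n) i - lp_val (f m) i| `^ p <= L j `^ p.
Proof.
move=> nm; apply: le_trans (lp_dist_partial p1 _ _ _) _.
apply: ge0_ler_powR; rewrite ?nnegrE ?(ltW p0) ?lp_dist_ge0 ?Lipj_lp_ge0 //.
exact: le_Lipj nm.
Qed.

(** Boundedness of [f] concerns distances only, so values are compared with the one at a fixed tuple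
    [n0], whose norm is finite. *)
Lemma partial_bounded : exists C, forall n (B : nat), incr n ->
  \sum_(0 <= i < B) `|lp_val (f n) i| `^ p <= C.
Proof.
have [C hC] := bf.
pose n0 := [tuple (i : nat) | i < k].
have incn0 : incr n0 by apply/incrP => i j; rewrite !tnth_mktuple.
pose y := f n0; pose S := limn (series (fun i => `|lp_val y i| `^ p)).
exists (2 `^ p * ((C `^ p + S) / 2)) => n B incn.
apply: le_trans (_ : \sum_(0 <= i < B) 2 `^ p *
  ((`|lp_val (f n) i - lp_val y i| `^ p + `|lp_val y i| `^ p) / 2) <= _).
  apply: ler_sum => i _; apply: le_trans (powR_add_le_convex _ _ (ltW p1)) => //.
  apply: ge0_ler_powR; rewrite ?nnegrE ?(ltW p0) ?addr_ge0 //.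
  by rewrite -{1}[lp_val (f n) i](subrK (lp_val y i)) ler_normD.
rewrite -mulr_sumr -mulr_suml big_split /= ler_wpM2l ?powR_ge0 //.
rewrite ler_wpM2r ?invr_ge0 // lerD //.
  apply: le_trans (lp_dist_partial p1 _ _ _) _.
  have dC := hC n n0 incn incn0.
  by apply: ge0_ler_powR; rewrite ?nnegrE ?(ltW p0) ?lp_dist_ge0 // (le_trans (lp_dist_ge0 _ _) dC).
have := @nondecreasing_cvgn_le R (series (fun i => `|lp_val y i| `^ p)).
by apply; [apply: nondecreasing_series => i _ _; apply: powR_ge0|exact: lp_valP].
Qed.

(** The conclusion in p-th powers, with three errors: [tau] from the triangle inequality on a block,
    [eta] from the mass off the blocks, [theta] from the Ramsey approximation on the head. *)
Lemma lp_estimate (tau eta theta : R) : 0 < tau -> 0 < eta -> 0 < theta ->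
  exists phi, {homo phi : x y / (x < y)%N} /\
  forall n m : k.-tuple nat, incr n -> incr m -> rho n m -> forall B : nat,
    \sum_(0 <= i < B) `|lp_val (f (map_tuple phi n)) i - lp_val (f (map_tuple phi m)) i| `^ p
    <= lam `^ p * (1 + tau) `^ p * (\sum_(j < k) L j `^ p + k%:R * theta) +
       2 `^ p * ((k%:R * (1 + tau^-1) `^ p + k.+1%:R) * eta).
Proof.
move=> tau0 eta0 theta0.
pose tup s := [tuple nth 0%N s i | i < k].
have tupE (n : k.-tuple nat) : tup n = n.
  by apply: eq_from_tnth => i; rewrite tnth_mktuple (tnth_nth 0%N).
have tup_val s : size s = k -> tup s = s :> seq nat.
  by move=> sk; rewrite -[s]/(tval (Tuple (introT eqP sk))) tupE.
pose F s := lp_val (f (tup s)).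
pose mu s i := `|F s i| `^ p.
have [C hC] := partial_bounded.
have mu0 s i : 0 <= mu s i by apply: powR_ge0.
have muC s B : size s = k -> sorted ltn s -> \sum_(0 <= i < B) mu s i <= C.
  by move=> sk ss; apply: hC; rewrite /incr tup_val.
(* The block structure comes first because it fixes [N], hence the finitely many coordinates to
   stabilise. Their errors [delta] then add up to at most [theta]. *)
have [psi [lo [hi [N [hpsi loN off tail]]]]] := block_structure mu0 muC eta0.
pose delta := theta / N.+1%:R.
have delta0 : 0 < delta by rewrite divr_gt0.
pose Q i (chi : nat -> nat) := exists kappa : nat -> R, [/\ forall j : 'I_k, 0 <= kappa j,
  forall u x y w, size (u ++ x :: w) = k -> sorted ltn (u ++ [:: x, y & w]) ->
    kappa (size u) - delta <= `|F (map psi (map chi (u ++ x :: w))) i -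
                               F (map psi (map chi (u ++ y :: w))) i| `^ p &
  forall n m : k.-tuple nat, incr n -> incr m -> rho n m ->
    `|F (map psi (map chi n)) i - F (map psi (map chi m)) i| `^ p
      <= lam `^ p * \sum_(j < k) kappa j].
have [chi [hchi Qchi]] : exists chi, {homo chi : x y / (x < y)%N} /\
    forall i, (i < N)%N -> Q i chi.
  apply: homo_subseq_iter => [i chi xi hxi [kappa [k0 hA hB]]|i chi _ hchi].
    have E s : map (chi \o xi) s = map chi (map xi s) by exact: map_comp.
    exists kappa; split => //.
      move=> u x y w uwk ss; rewrite !E !(map_cat xi) /=.
      have := hA (map xi u) (xi x) (xi y) (map xi w).
      rewrite size_map; apply; first by rewrite -map_cons -map_cat size_map.
      by rewrite -!map_cons -map_cat sorted_map_homo.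
    move=> n m incn incm nm; rewrite !E.
    apply: (hB (map_tuple xi n) (map_tuple xi m)); rewrite ?incr_map //.
    exact/rhoI.
  pose h s := F (map psi (map chi s)) i.
  have hbound s : size s = k -> sorted ltn s -> `|h s| <= C `^ p^-1.
    move=> sk ss.
    have muiC : `|h s| `^ p <= C.
      have := muC (map psi (map chi s)) i.+1; rewrite !size_map !sorted_map_homo //.
      move=> /(_ sk ss); apply: le_trans; rewrite big_nat_recr //= lerDr.
      exact: sumr_ge0.
    have pV0 : 0 <= p^-1 by rewrite invr_ge0 ltW.
    have := ge0_ler_powR pV0 _ _ muiC; rewrite -powRrM mulfV ?gt_eqF // powRr1 //.
    by apply; rewrite nnegrE ?powR_ge0 // (le_trans _ muiC) ?powR_ge0.
  have [xi [kappa [hxi k0 hA hB]]] := coordinate_concentration p0 lam0 delta0 hbound (@conc i).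
  have E s : map (chi \o xi) s = map chi (map xi s) by exact: map_comp.
  exists xi; split => //; exists kappa; split => //.
    by move=> u x y w uwk ss; rewrite !E; apply: hA.
  by move=> n m incn incm nm; rewrite !E; apply: hB.
have /choice[kap kapP] : forall i, exists kappa : nat -> R, (i < N)%N ->
  [/\ forall j : 'I_k, 0 <= kappa j,
  forall u x y w, size (u ++ x :: w) = k -> sorted ltn (u ++ [:: x, y & w]) ->
    kappa (size u) - delta <= `|F (map psi (map chi (u ++ x :: w))) i -
                               F (map psi (map chi (u ++ y :: w))) i| `^ p &
  forall n m : k.-tuple nat, incr n -> incr m -> rho n m ->
    `|F (map psi (map chi n)) i - F (map psi (map chi m)) i| `^ p
      <= lam `^ p * \sum_(j < k) kappa j].
  move=> i; case: (ltnP i N) => [iN|_]; last by exists (fun=> 0).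
  by have [kap ?] := Qchi i iN; exists kap.
pose G s := F (map psi (map chi s)).
pose K j := \sum_(0 <= i < N) kap i j.
pose J v s := \sum_(lo v <= i < hi v) mu (map psi (map chi s)) i.
have Ndelta : N%:R * delta <= theta.
  rewrite /delta mulrCA ler_piMr ?(ltW theta0) // ler_pdivrMr ?mul1r ?ler_nat //.
(* The mass of the block attached to the [j]-th entry [x] has to move when [x] is
   replaced by [y], on top of the oscillation of the first [N] coordinates. *)
have block u x y w (j : 'I_k) : size u = j -> size (u ++ x :: w) = k ->
    sorted ltn (u ++ [:: x, y & w]) ->
    0 <= L j `^ p - K j + theta /\
    J (chi x) (u ++ x :: w) <= (1 + tau) `^ p * (L j `^ p - K j + theta) + (1 + tau^-1) `^ p * eta.
  move=> uj uxk ss; have [sx sy] := sorted_ltn_del ss.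
  have uyk : size (u ++ y :: w) = k by rewrite -uxk !size_cat.
  set s := u ++ x :: w; set t := u ++ y :: w; set v := chi x.
  have Hst : Hrel j (tup (map psi (map chi s))) (tup (map psi (map chi t))).
    apply/HrelP; pose c := psi \o chi.
    exists (map c u), (c x), (c y), (map c w).
    rewrite !tup_val ?size_map // -!map_comp -!map_cons -!map_cat.
    by rewrite sorted_map_homo //; exact: homo_ltn_comp.
  have lowK : K j - theta <= \sum_(0 <= i < N) `|G s i - G t i| `^ p.
    apply: le_trans (_ : \sum_(0 <= i < N) (kap i j - delta) <= _).
      by rewrite big_split /= sumr_const_nat subn0 mulNrn -mulr_natl lerD2l lerN2.
    apply: ler_sum_nat => i /andP[_ iN]; have [_ hA _] := kapP i iN.
    by rewrite -uj; apply: hA.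
  have [Nlo lohi] : (N <= lo v)%N /\ (lo v <= hi v)%N by apply/andP.
  (* Head and block are disjoint since [N <= lo v], so both fit in one partial sum. *)
  have upL : \sum_(0 <= i < N) `|G s i - G t i| `^ p +
      \sum_(lo v <= i < hi v) `|G s i - G t i| `^ p <= L j `^ p.
    apply: le_trans (partial_le_Lipj (hi v) Hst).
    rewrite [leRHS](@big_cat_nat _ _ _ N) //= ?(leq_trans Nlo) // lerD2l.
    rewrite [leRHS](@big_cat_nat _ _ _ (lo v)) //= lerDr.
    by apply: sumr_ge0 => i _; apply: powR_ge0.
  (* [x] does not occur in [t], so the block of [chi x] carries little mass of the value at [t]. *)
  have offt : J v t <= eta.
    apply: off; rewrite ?size_map ?sorted_map_homo //.
    rewrite mem_map; last exact: incn_inj (leq_mono hchi).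
    move: ss; rewrite /t sorted_ltn_cat mem_cat inE allrel_consr.
    move=> /and3P[/andP[xu _] _]; rewrite /= (path_sortedE ltn_trans).
    move=> /and3P[xy /allP yw _]; apply/negP => /orP[/(allP xu)|/orP[/eqP xy'|/yw]] /=.
    - by rewrite ltnn.
    - by rewrite xy' ltnn in xy.
    - by rewrite ltnNge (ltnW xy).
  have d0 : 0 <= \sum_(lo v <= i < hi v) `|G s i - G t i| `^ p.
    by apply: sumr_ge0 => i _; apply: powR_ge0.
  split; first by lra.
  apply: le_trans (_ : (1 + tau) `^ p * \sum_(lo v <= i < hi v) `|G s i - G t i| `^ p +
    (1 + tau^-1) `^ p * J v t <= _); last first.
    by apply: lerD; apply: ler_wpM2l; rewrite ?powR_ge0 //; lra.
  rewrite !mulr_sumr -big_split /=; apply: ler_sum => i _.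
  apply: le_trans (powR_add_le _ _ (ltW p0) tau0) => //.
  apply: ge0_ler_powR; rewrite ?nnegrE ?(ltW p0) ?addr_ge0 //.
  by rewrite -{1}[F _ i](subrK (G t i)) ler_normD.
(* Doubling leaves room: an entry 2x can be moved to 2x + 1 without meeting the next entry, so
   [block] applies to every entry. *)
have hdbl : {homo double : x y / (x < y)%N} by move=> x y; rewrite ltn_double.
have tail_bound (n : k.-tuple nat) (B : nat) : incr n ->
    \sum_(N <= i < B) `|G (map double n) i| `^ p <=
      (1 + tau) `^ p * \sum_(j < k) (L j `^ p - K j + theta) +
      (k%:R * (1 + tau^-1) `^ p + k.+1%:R) * eta /\
    forall j, 0 <= L j `^ p - K j + theta.
  move=> incn.
  have blk (j : 'I_k) : 0 <= L j `^ p - K j + theta /\ J (chi (tnth n j).*2) (map double n) <=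
      (1 + tau) `^ p * (L j `^ p - K j + theta) + (1 + tau^-1) `^ p * eta.
    have En : map double n = map double (take j n) ++ (tnth n j).*2 :: map double (drop j.+1 n).
      by rewrite {1}(tuple_split n j) map_cat.
    rewrite En; apply: (block _ _ (tnth n j).*2.+1).
    - by rewrite size_map size_takel // size_tuple ltnW.
    - by rewrite -En size_map size_tuple.
    have := incn; rewrite /incr {1}(tuple_split n j) !sorted_ltn_cat !allrel_consr.
    move=> /and3P[/andP[un unw] su]; rewrite !sorted_map_homo // su /=.
    rewrite !(path_sortedE ltn_trans) sorted_map_homo // => /andP[nw ->].
    rewrite !all_map ltnSn /= !andbT; apply/andP; split.
      apply/and3P; split.
      - by apply: sub_all un => z /=; rewrite ltn_double.
      - by apply: sub_all un => z /=; rewrite -ltn_double => /ltn_trans; apply.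
      - apply/allrelP => a b /mapP[a' ha ->] /mapP[b' hb ->] /=.
        by rewrite ltn_double; apply: (allrelP unw).
    by apply: sub_all nw => z /=; rewrite ltn_Sdouble.
  split; last by move=> j; have [] := blk j.
  apply: le_trans (tail (map chi (map double n)) B _ _) _.
  - by rewrite !size_map size_tuple.
  - by rewrite !sorted_map_homo.
  rewrite mulrDl addrA lerD2r !big_map big_tuple.
  apply: le_trans (ler_sum _ (fun j _ => (blk j).2)) _.
  by rewrite big_split /= -mulr_sumr sumr_const card_ord lerD2l -mulrA mulr_natl.
exists (psi \o (chi \o double)); split.
  by apply: homo_ltn_comp => //; exact: homo_ltn_comp.
move=> n m incn incm nm B.
have fE (n' : k.-tuple nat) : 
    lp_val (f (map_tuple (psi \o (chi \o double)) n')) = G (map double n').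
  rewrite /G /F; congr (lp_val (f _)); apply: val_inj => /=.
  by rewrite tup_val ?size_map ?size_tuple // -!map_comp.
rewrite !fE; set s := map double n; set t := map double m.
have [tn Lpos] := tail_bound n (maxn N B) incn; have [tm _] := tail_bound m (maxn N B) incm.
have head : \sum_(0 <= i < N) `|G s i - G t i| `^ p <= lam `^ p * \sum_(j < k) K j.
  rewrite exchange_big /= mulr_sumr; apply: ler_sum_nat => i /andP[_ iN].
  have [_ _ hB] := kapP i iN.
  by apply: (hB (map_tuple double n) (map_tuple double m)); rewrite ?incr_map //; exact/rhoI.
have K0 : 0 <= \sum_(j < k) K j.
  apply: sumr_ge0 => j _; rewrite /K big_nat; apply: sumr_ge0 => i /andP[_ iN].
  by have [k0 _ _] := kapP i iN.
set W := \sum_(j < k) L j `^ p.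
have SE : \sum_(j < k) (L j `^ p - K j + theta) = W - \sum_(j < k) K j + k%:R * theta.
  by rewrite !big_split /= sumrN sumr_const card_ord mulr_natl.
have S0 : 0 <= W - \sum_(j < k) K j + k%:R * theta by rewrite -SE; apply: sumr_ge0.
rewrite SE in tn tm.
set E := (1 + tau) `^ p * _ + _ in tn tm.
have both : \sum_(N <= i < maxn N B) `|G s i - G t i| `^ p <= 2 `^ p * E.
  apply: le_trans (_ : \sum_(N <= i < maxn N B)
    2 `^ p * ((`|G s i| `^ p + `|G t i| `^ p) / 2) <= _).
    apply: ler_sum => i _; apply: le_trans (powR_add_le_convex _ _ (ltW p1)) => //.
    by apply: ge0_ler_powR; rewrite ?nnegrE ?(ltW p0) ?addr_ge0 ?ler_normB.
  rewrite -mulr_sumr -mulr_suml big_split /= ler_wpM2l ?powR_ge0 //; lra.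
apply: le_trans (_ : \sum_(0 <= i < maxn N B) `|G s i - G t i| `^ p <= _).
  rewrite [leRHS](@big_cat_nat _ _ _ B) //= ?leq_maxr // lerDl.
  by apply: sumr_ge0 => i _; apply: powR_ge0.
rewrite (@big_cat_nat _ _ _ N) //= ?leq_maxl //.
have two_lam : 2 `^ p <= lam `^ p by apply: ge0_ler_powR; rewrite ?nnegrE ?(ltW p0).
have tau1 : 1 <= (1 + tau) `^ p.
  have := @ge0_ler_powR R p (ltW p0) 1 (1 + tau); rewrite powR1; apply; rewrite ?nnegrE //; lra.
move: head both; rewrite /E; clear - lam0 two_lam tau1 S0 K0.
move: (\sum_(j < k) K j) S0 K0 => S S0 K0 head both.
set T := (1 + tau) `^ p in tau1 both *.
(* Since [2 <= lam] and [1 <= T], head and tail can be given the same factor, and the head sum [S]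
   cancels. The nonnegativity [S0] is essential here. *)
have h1 : 2 `^ p * (T * (W - S + k%:R * theta)) <= lam `^ p * (T * (W - S + k%:R * theta)).
  by rewrite ler_wpM2r // mulr_ge0 // powR_ge0.
have h2 : lam `^ p * S <= lam `^ p * (T * S) by rewrite ler_wpM2l ?powR_ge0 // ler_peMl.
nra.
Qed.

End LpConcentration.

(** * Choice of the error parameters, and the two properties *)

Lemma lp_concentrates (R : realType) (X : nat -> completeNormedModType R) (p lam eps : R)
    (rho : forall k : nat, k.-tuple nat -> k.-tuple nat -> Prop) :
  1 < p -> 2 <= lam -> 0 < eps -> reindexing_invariant rho ->
  (forall n, concentrates rho (@normdist R (X n)) lam p) ->
  concentrates rho (@lp_dist R X p) (lam + eps) p.
Proof.
move=> p1 lam2 eps0 rhoI conc k f bf.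
have p0 : 0 < p by apply: lt_trans p1.
have lam0 : 0 < lam by apply: lt_le_trans lam2.
pose W := \sum_(j < k) Lipj (@lp_dist R X p) f j `^ p.
suff [phi [hphi hf]] : exists phi, {homo phi : x y / (x < y)%N} /\
    forall n m : k.-tuple nat, incr n -> incr m -> rho k n m -> forall B : nat,
    \sum_(0 <= i < B) `|lp_val (f (map_tuple phi n)) i - lp_val (f (map_tuple phi m)) i| `^ p
      <= (lam + eps) `^ p * W.
  exists phi; split => // n m incn incm nm; apply: lp_dist_le => //.
    by rewrite mulr_ge0 ?powR_ge0 // addr_ge0 ?ltW.
  move=> B; rewrite powRM ?powR_ge0 // ?Lip_bound_powR //; first exact: hf.
  by rewrite addr_ge0 // ltW.
have : 0 <= W by apply: sumr_ge0 => j _; apply: powR_ge0.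
(* When all Lipschitz constants vanish there is no slack to absorb errors, but [f] is then constant
   in every coordinate. *)
rewrite le_eqVlt => /predU1P[W0|W0].
  exists id; split => // n m incn incm _ B.
  have fconst : lp_val (f (map_tuple id n)) = lp_val (f (map_tuple id m)).
    apply: (@Hrel_invariant_const k _ (fun n => lp_val (f n))); rewrite ?incr_map //.
    move=> j n' m' nm; apply: functional_extensionality_dep => i.
    have Lj0 : Lipj (@lp_dist R X p) f j `^ p = 0.
      by apply: (psumr_eq0P (P := xpredT) _ (esym W0)) => // j' _; apply: powR_ge0.
    have := partial_le_Lipj p1 bf i.+1 nm; rewrite Lj0 big_nat_recr //= => h.
    have : `|lp_val (f n') i - lp_val (f m') i| `^ p <= 0.
      by apply: le_trans h; rewrite lerDr; apply: sumr_ge0 => i' _; apply: powR_ge0.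
    rewrite le_eqVlt ltNge powR_ge0 orbF powR_eq0 => /andP[+ _].
    by rewrite normr_eq0 subr_eq0 => /eqP.
  by rewrite fconst -W0 mulr0 big1 // => i _; rewrite subrr normr0 powR0 // gt_eqF.
(* Chosen so that [lam * (1 + tau) = lam + eps / 2]. *)
pose tau := eps / 2 / lam; pose La := (lam + eps / 2) `^ p.
have tau0 : 0 < tau by rewrite !divr_gt0.
have LaE : La = lam `^ p * (1 + tau) `^ p.
  rewrite /La -powRM ?(ltW lam0) ?addr_ge0 ?(ltW tau0) //.
  by rewrite mulrDr mulr1 /tau [lam * (_ / lam)]mulrC divfK ?gt_eqF.
have La0 : 0 < La by apply: powR_gt0; lra.
have LaLt : La < (lam + eps) `^ p.
  by apply: gt0_ltr_powR; rewrite ?nnegrE //; lra.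
pose c := 2 `^ p * (k%:R * (1 + tau^-1) `^ p + k.+1%:R).
have c0 : 0 < c.
  by rewrite mulr_gt0 ?powR_gt0 // ltr_wpDl ?mulr_ge0 ?powR_ge0.
(* The slack between [lam + eps / 2] and [lam + eps]: one half pays for [theta], the other for
   [eta]. *)
pose De := ((lam + eps) `^ p - La) * W.
have De0 : 0 < De by rewrite mulr_gt0 // subr_gt0.
have theta0 : 0 < De / 2 / La / k.+1%:R by do 3 rewrite divr_gt0 //.
have eta0 : 0 < De / (2 * c) by rewrite divr_gt0 // mulr_gt0.
have [phi [hphi hf]] := lp_estimate p1 lam2 rhoI conc bf tau0 eta0 theta0.
exists phi; split => // n m incn incm nm B; apply: le_trans (hf n m incn incm nm B) _.
rewrite -LaE -/W [2 `^ p * _]mulrA -/c.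
have -> : c * (De / (2 * c)) = De / 2 by field; rewrite gt_eqF.
have hk : k%:R * (De / 2 / La / k.+1%:R) <= De / 2 / La.
  rewrite mulrCA.
  rewrite ler_piMr ?divr_ge0 ?(ltW De0) ?(ltW La0) //.
  by rewrite ler_pdivrMr // mul1r ler_nat.
have hLa : La * (De / 2 / La) = De / 2 by field; rewrite gt_eqF.
have := ler_wpM2l (ltW La0) hk; rewrite hLa mulrDr => h.
apply: le_trans (_ : La * W + De / 2 + De / 2 <= _); first by rewrite lerD2r lerD2l.
by rewrite -addrA -splitr /De mulrBl addrC subrK.
Qed.

Theorem theorem1p2 (R : realType) (X : nat -> completeNormedModType R) (p lam : R) :
  1 < p -> 2 <= lam ->
  ((forall n, HFC (@normdist R (X n)) lam p) ->
     forall eps : R, 0 < eps -> HFC (@lp_dist R X p) (lam + eps) p) /\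
  ((forall n, HIC (@normdist R (X n)) lam p) ->
     forall eps : R, 0 < eps -> HIC (@lp_dist R X p) (lam + eps) p).
Proof.
move=> p1 lam2; split.
  pose rho k (_ _ : k.-tuple nat) := True.
  have rhoI : reindexing_invariant rho by [].
  have HFCE (T : Type) (d : T -> T -> R) mu : concentrates rho d mu p <-> HFC d mu p.
    rewrite (concentratesP _ _ _ rhoI); split=> h k f bf; have [M [Minf hM]] := h k f bf;
      exists M; split => // n m nM mM; first exact: hM.
    by move=> _; apply: hM.
  move=> H eps eps0; apply/HFCE; apply: lp_concentrates => // n; exact/HFCE.
(* The interlacing part of [Irel]; membership in [M] is handled by [concentratesP]. *)
pose rho k (n m : k.-tuple nat) := (forall i : 'I_k, (tnth n i < tnth m i)%N) /\
  (forall i i' : 'I_k, (i' = i.+1 :> nat) -> (tnth m i < tnth n i')%N).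
have rhoI : reindexing_invariant rho.
  move=> k phi n m /homo_ltn_mono mphi; rewrite /rho; split=> -[h1 h2]; split.
  - by move=> i; have := h1 i; rewrite !tnth_map mphi.
  - by move=> i i' /h2; rewrite !tnth_map mphi.
  - by move=> i; rewrite !tnth_map mphi.
  - by move=> i i' /h2; rewrite !tnth_map mphi.
have HICE (T : Type) (d : T -> T -> R) mu : concentrates rho d mu p <-> HIC d mu p.
  rewrite (concentratesP _ _ _ rhoI); split=> h k f bf; have [M [Minf hM]] := h k f bf;
    exists M; split => // n m; last by move=> nM mM [h1 h2]; apply: hM.
  by move=> [nM [mM nm]]; apply: hM.
move=> H eps eps0; apply/HICE; apply: lp_concentrates => // n; exact/HICE.
Qed.
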